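(* Let $X$ be a discrete random variable taking values in the nonnegative integers, and let $N$ be a positive integer. Then $$\frac{1}{N}\lim_{z\rightarrow1^{-}}\frac{\partial^N}{\partial z^N}\mathbb{E}[z^X]=\sum_{n=0}^{\infty}\left(\prod_{j=1}^{N-1}(n+j)\right)P(X>n+N-1)=\frac{1}{N}\,\mathbb{E}[X(X-1)\cdots(X-N+1)].$$
   Context: Here $\mathbb{E}[z^X]=\sum_{n=0}^{\infty}P(X=n)z^n$ is the probability generating function of $X$, regarded as a function of $z$ with $|z|<1$, and $z\to1^-$ denotes the limit along real $z<1$. An empty product (the case $N=1$) equals $1$. All three quantities are understood in $[0,\infty]$. *)

(* Defs.v *)
From HB Require Import structures.
From mathcomp Require Import all_boot all_order all_algebra.
From mathcomp Require Import all_classical all_reals all_analysis.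
Set Implicit Arguments.
Unset Strict Implicit.
Unset Printing Implicit Defensive.
Import Order.TTheory GRing.Theory Num.Theory.
Import numFieldNormedType.Exports.

Local Open Scope ring_scope.

(* [fine] maps infinite values to 0, but for |z| < 1 the expectation of z ^ X
   is finite, so nothing is truncated on the open unit interval. *)
Definition pgf (R : realType) (d : measure_display) (T : measurableType d)
    (P : probability T R) (X : {RV P >-> nat}) (z : R) : R :=
  fine 'E_P[fun w => z ^+ X w].
Arguments pgf {R d T} P X z.

(* Main.v *)
(* Near any z in (-1, 1) the generating function is the power series of the
   probability mass function p, so its N-th derivative is the power series with
   the nonnegative coefficients (n + N) (n + N - 1) ... (n + 1) p (n + N). By
   monotone convergence of such series as z tends to 1 from the left, the limit
   is their sum, which is the N-th factorial moment, finite or not. On the other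
   hand N times the tail sum is the expectation of the sum over n of
   N (n + 1) ... (n + N - 1) 1_(n + N - 1 < X), which the hockey-stick identity
   for falling factorials evaluates pointwise to X (X - 1) ... (X - N + 1). *)
Require Import Defs.
From HB Require Import structures.
From mathcomp Require Import all_boot all_order all_algebra.
From mathcomp Require Import all_classical all_reals all_analysis.
From mathcomp Require Import measurable_realfun lra.
Set Implicit Arguments.
Unset Strict Implicit.
Unset Printing Implicit Defensive.
Import Order.TTheory GRing.Theory Num.Theory.
Import numFieldNormedType.Exports.

Local Open Scope classical_set_scope.
Local Open Scope ring_scope.

(** * Termwise differentiation of power series on the unit disc *)

(** The left side is one term of the binomial expansion of the right side. It absorbs the factor
    [n.+1] created by differentiation into a slightly larger radius. *)
Lemma ler_exprD_bernoulli (R : realDomainType) (a h : R) n : 0 <= a -> 0 <= h ->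
  n.+1%:R * a ^+ n * h <= (a + h) ^+ n.+1.
Proof.
move=> a0 h0; elim: n => [|n IHn]; first by rewrite expr0 expr1; lra.
have le1 : a ^+ n.+1 <= (a + h) ^+ n.+1 by rewrite lerXn2r ?nnegrE; lra.
have := ler_wpM2l a0 IHn; have := ler_wpM2l h0 le1.
by rewrite (exprS (a + h) n.+1) (exprS a n) -(natr1 n.+1); lra.
Qed.

(** With [r = |z| + h] the midpoint of [|z|] and [|x|], the Bernoulli bound gives
    [n.+1 * |z|^n <= r^n.+1 / h]. The derived series at [z] is thus dominated by the series at [r],
    which converges absolutely. *)
Lemma is_cvg_pseries_diffs (R : realType) (c : R^nat) (x z : R) :
  cvgn (pseries c x) -> `|z| < `|x| -> cvgn (pseries (pseries_diffs c) z).
Proof.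
move=> cx zx; pose h := (`|x| - `|z|) / 2.
have h0 : 0 < h by rewrite /h; lra.
pose r := `|z| + h.
have r0 : 0 < r by rewrite /r ltr_wpDl.
have /(is_cvg_pseries_inside_norm cx) cr : `|r| < `|x|.
  by rewrite gtr0_norm// /r /h; lra.
apply: normed_cvg.
apply: (@series_le_cvg _ _ (fun n => h^-1 * (`|c n.+1| * r ^+ n.+1))) => /=.
- by move=> n.
- by move=> n; rewrite !mulr_ge0 ?invr_ge0 ?exprn_ge0// ltW.
- move=> n; rewrite /pseries_diffs !normrM normrX normr_nat.
  rewrite [leRHS]mulrCA [leLHS]mulrAC [leLHS]mulrC ler_wpM2l// ler_pdivlMl//.
  by rewrite mulrC ler_exprD_bernoulli// ltW.
- apply: is_cvg_seriesZ.
  suff -> : series (fun n => `|c n.+1| * r ^+ n.+1)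
      = (fun n => pseries (fun i => `|c i|) r n.+1 - `|c 0| * r ^+ 0).
    apply: is_cvgB; last exact: is_cvg_cst.
    by move/cvg_ex : cr => [l cl]; apply/cvg_ex; exists l; rewrite cvg_shiftS.
  apply/funext => n.
  by rewrite /pseries /series/= big_nat_recl// addrAC subrr add0r.
Qed.

Section unit_disc.
Context {R : realType}.
Implicit Types (c : R^nat) (f : R -> R).

Definition cvg_on_unit_disc c := forall z : R, `|z| < 1 -> cvgn (pseries c z).

Lemma exists_norm_between (z : R) : `|z| < 1 -> exists2 r : R, `|z| < `|r| & `|r| < 1.
Proof.
move=> z1; have z0 := normr_ge0 z; exists ((`|z| + 1) / 2).
  by rewrite [ltRHS]ger0_norm; lra.
by rewrite ger0_norm; lra.
Qed.

Lemma is_cvg_pseries_diffs_disc c : cvg_on_unit_disc c -> cvg_on_unit_disc (pseries_diffs c).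
Proof.
by move=> cc z /exists_norm_between[r zr /cc cr]; exact: is_cvg_pseries_diffs cr zr.
Qed.

Lemma is_cvg_iter_pseries_diffs_disc k c : cvg_on_unit_disc c ->
  cvg_on_unit_disc (iter k (@pseries_diffs R) c).
Proof. by move=> cc; elim: k => //= k; exact: is_cvg_pseries_diffs_disc. Qed.

Lemma is_derive_pseries_disc f c : cvg_on_unit_disc c ->
  (forall z : R, `|z| < 1 -> f z = limn (pseries c z)) ->
  forall z : R, `|z| < 1 ->
    is_derive z (1 : R) f (limn (pseries (pseries_diffs c) z)).
Proof.
move=> cc fc z z1; have [r zr r1] := exists_norm_between z1.
have zfc : \forall x \near z, limn (pseries c x) = f x.
  near=> x; rewrite fc//; near: x.
  exact: (@cvgr_norm_lt _ _ _ _ _ id z cvg_id 1 z1).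
apply: (@near_eq_is_derive R R^o R^o _ _ z 1 _ zfc).
(* Termwise differentiation at [z] asks that the series and its first two derived series converge at
   [r], farther out than [z]. *)
apply: (pseries_snd_diffs _ _ _ zr); first exact: cc.
  exact: (is_cvg_pseries_diffs_disc cc).
exact: (is_cvg_pseries_diffs_disc (is_cvg_pseries_diffs_disc cc)).
Unshelve. all: by end_near. Qed.

Lemma derive1n_pseries_disc f c : cvg_on_unit_disc c ->
  (forall z : R, `|z| < 1 -> f z = limn (pseries c z)) ->
  forall k (z : R), `|z| < 1 ->
    (f^`(k))%classic z = limn (pseries (iter k (@pseries_diffs R) c) z).
Proof.
move=> cc fc; elim=> [|k IHk] z z1; first by rewrite derive1n0 fc.
rewrite derive1nS derive1E.
by have := is_derive_pseries_disc (@is_cvg_iter_pseries_diffs_disc k c cc) IHk z1;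
  case.
Qed.

End unit_disc.

(** * Limit of a nonnegative power series at 1 from the left *)

Lemma cvg_pseries_at_left1 (R : realType) (c : R^nat) :
  (forall n, 0 <= c n) -> cvg_on_unit_disc c ->
  (limn (pseries c z))%:E @[z --> (1 : R)^'-] -->
    (\sum_(0 <= n <oo) (c n)%:E)%E.
Proof.
move=> c0 cc; set S := (\sum_(0 <= n <oo) _)%E.
have z01 : \forall z \near (1 : R)^'-, 0 <= z < 1.
  near=> z; apply/andP; split; near: z; last exact: nbhs_left_lt.
  by apply: nbhs_left_ge; exact: ltr01.
have term0 (z : R) n : 0 <= z -> 0 <= c n * z ^+ n.
  by move=> z0; rewrite mulr_ge0// exprn_ge0.
have cvg01 (z : R) : 0 <= z < 1 -> cvgn (pseries c z).
  by move=> /andP[z0 z1]; apply: cc; rewrite ger0_norm.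
have partial_le (z : R) n : 0 <= z < 1 -> pseries c z n <= limn (pseries c z).
  move=> /[dup] /andP[z0 z1] /cvg01 cz; apply: nondecreasing_cvgn_le => //.
  by apply: nondecreasing_series => k _ _; exact: term0.
have leS : \forall z \near (1 : R)^'-, ((limn (pseries c z))%:E <= S)%E.
  near=> z; have /andP[z0 z1] : 0 <= z < 1 by near: z.
  rewrite -EFin_lim; last by apply: cvg01; rewrite z0.
  apply: lime_le.
    apply/cvg_ex; exists (limn (pseries c z))%:E.
    apply: cvg_EFin; first exact: nearW.
    by apply: cvg01; rewrite z0.
  apply: nearW => n; rewrite /pseries /series/= -sumEFin.
  apply: (@le_trans _ _ (\sum_(0 <= k < n) (c k)%:E)%E).
    by apply: lee_sum => k _; rewrite lee_fin ler_piMr// exprn_ile1// ltW.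
  by apply: nneseries_lim_ge => k _ _; rewrite lee_fin.
have ltS (a : R) : (a%:E < S)%E ->
    \forall z \near (1 : R)^'-, a < limn (pseries c z).
  move=> aS.
  (* Since [a] lies below the supremum [S] of the partial sums at 1, some partial sum at 1 already
     exceeds [a]. *)
  have [n an] : exists n, a < pseries c 1 n.
    apply/not_existsP => na; move: aS; apply/negP; rewrite -leNgt.
    apply: lime_le.
      by apply: is_cvg_nneseries => n _ _; rewrite lee_fin.
    apply: nearW => n; rewrite sumEFin lee_fin leNgt; apply/negP => an.
    apply: (na n); rewrite /pseries /series/=.
    by under eq_bigr do rewrite expr1n mulr1.
  near=> z; apply: (@lt_le_trans _ _ (pseries c z n)); last first.
    by apply: partial_le; near: z.
  (* For this fixed [n] the partial sum is a polynomial in [z], so by continuity it still exceeds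
     [a] for [z] close to 1. *)
  near: z; apply: (cvgr_gt (pseries c 1 n)) => //.
  apply: cvg_at_left_filter.
  have pseriesE z : pseries c z n = (\poly_(i < n) c i).[z].
    by rewrite horner_poly /pseries /series/= big_mkord.
  by under eq_fun do rewrite pseriesE; rewrite pseriesE; exact: continuous_horner.
have : (0 <= S)%E by apply: nneseries_ge0 => n _ _; rewrite lee_fin.
(* A finite [S] is squeezed between [leS] and [ltS]; for an infinite [S], [ltS] alone gives
   divergence. *)
case: S leS ltS => [r| |] // leS ltS _.
- apply: cvg_EFin; first exact: nearW.
  apply/cvgrPdist_le => e e0; near=> z => /=.
  rewrite ger0_norm; last by rewrite subr_ge0 -lee_fin; near: z.
  rewrite lerBlDl -lerBlDr ltW//; near: z; apply: ltS.
  by rewrite lte_fin ltrBlDr ltrDl.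
- by apply/cvgeyPgt => A; near do rewrite lte_fin; exact: ltS (ltry _).
Unshelve. all: by end_near. Qed.

(** * Falling factorial identities *)

(* The case k + 1 = N evaluates the weights of the tail sum:
   N * \sum_(n < K) (n + 1) ... (n + N - 1) = K (K + 1) ... (K + N - 1). *)
Lemma sum_ffact_hockey_stick k K :
  (k.+1 * \sum_(0 <= n < K) (n + k) ^_ k = (K + k) ^_ k.+1)%N.
Proof.
elim: K => [|K IHK]; first by rewrite big_nil muln0 ffact_small.
rewrite big_nat_recr//= mulnDr IHK addSn ffactSS ffactnSr addnK mulnC.
by rewrite -mulnDl addnC addSnnS addnC.
Qed.

Lemma prod_ffact (n k : nat) :
  (\prod_(1 <= j < k.+1) (n + j) = (n + k) ^_ k)%N.
Proof.
elim: k => [|k IHk]; first by rewrite big_nil.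
by rewrite big_nat_recr//= IHk addnS ffactSS mulnC.
Qed.

Lemma prodB_ffact (R : pzRingType) (m N : nat) :
  \prod_(0 <= i < N) (m%:R - i%:R) = (m ^_ N)%:R :> R.
Proof.
elim: N => [|N IHN]; first by rewrite big_nil.
rewrite big_nat_recr//= IHN ffactnSr natrM.
(* When [m < N] the natural subtraction [m - N] truncates, but the factor [m ^_ N] is already
   zero. *)
by have [Nm|mN] := leqP N m; [rewrite natrB|rewrite ffact_small// !mul0r].
Qed.

Lemma iter_pseries_diffs (R : realType) (c : R^nat) k n :
  iter k (@pseries_diffs R) c n = ((n + k) ^_ k)%:R * c (n + k)%N.
Proof.
elim: k n => [|k IHk] n; first by rewrite addn0 mul1r.
rewrite iterS /pseries_diffs IHk mulrA -natrM addSnnS; congr (_%:R * _).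
by rewrite ffactnSr mulnC -addSnnS addnK.
Qed.

(** * Expectations as series over the mass function *)

Section nat_random_variable.
Context d (T : measurableType d) (R : realType) (P : probability T R).
Variable X : {RV P >-> nat}.

Definition natpmf (n : nat) : R := fine (P (X @^-1` [set n])).

Lemma measurable_RVnat (A : set nat) : measurable (X @^-1` A).
Proof. by rewrite -[_ @^-1` _]setTI; exact: measurable_funPT. Qed.

Lemma natpmf_ge0 n : 0 <= natpmf n.
Proof. exact: fine_ge0. Qed.

Lemma natpmf_le1 n : natpmf n <= 1.
Proof.
rewrite -lee_fin fineK; last exact/fin_num_measure/measurable_RVnat.
exact/probability_le1/measurable_RVnat.
Qed.

Lemma measurable_fun_comp_RVnat (f : nat -> R) : measurable_fun setT (f \o X).
Proof. by apply: measurableT_comp => //. Qed.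

Let bigcup_RVnat : \bigcup_n (X @^-1` [set n]) = setT.
Proof. by apply/seteqP; split => // w _; exists (X w). Qed.

Let trivIset_RVnat : trivIset setT (fun n => X @^-1` [set n]).
Proof. by move=> i j _ _ [w [/= <- <-]]. Qed.

Let integral_RVnat_slice (f : nat -> R) n :
  (\int[P]_(w in X @^-1` [set n]) (f (X w))%:E = (f n * natpmf n)%:E)%E.
Proof.
rewrite (eq_integral (cst (f n)%:E)); last by move=> w; rewrite inE/= => ->.
rewrite integral_cst; last exact: measurable_RVnat.
by rewrite EFinM fineK//; exact/fin_num_measure/measurable_RVnat.
Qed.

Lemma ge0_expectation_RVnat (f : nat -> R) : (forall n, 0 <= f n) ->
  ('E_P[fun w => f (X w)] = \sum_(0 <= n <oo) (f n * natpmf n)%:E)%E.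
Proof.
move=> f0; rewrite unlock -bigcup_RVnat ge0_integral_bigcup//=.
- by apply: eq_eseriesr => n _; exact: integral_RVnat_slice.
- by move=> n; exact: measurable_RVnat.
- rewrite bigcup_RVnat; apply/measurable_EFinP; exact: measurable_fun_comp_RVnat.
- by move=> w _; rewrite lee_fin.
Qed.

(** The generating function is also taken at negative [z], where its terms change sign.
    Integrability replaces nonnegativity: the constant 1 dominates and is integrable for a
    probability. *)
Lemma bounded_expectation_RVnat (f : nat -> R) : (forall n, `|f n| <= 1) ->
  ('E_P[fun w => f (X w)] = \sum_(0 <= n <oo) (f n * natpmf n)%:E)%E.
Proof.
move=> f1; rewrite unlock -bigcup_RVnat integral_bigcup//=.
- by apply: eq_eseriesr => n _; exact: integral_RVnat_slice.
- by move=> n; exact: measurable_RVnat.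
- rewrite bigcup_RVnat; apply: (@le_integrable _ _ _ _ _ _ _ (EFin \o cst 1)) => //.
  + apply/measurable_EFinP; exact: measurable_fun_comp_RVnat.
  + by move=> w _ /=; rewrite lee_fin normr1.
  + exact: finite_measure_integrable_cst.
Qed.

Lemma is_cvg_pseries_natpmf : cvg_on_unit_disc natpmf.
Proof.
(* Each mass is at most 1, so the geometric series of ratio [|z|] dominates. *)
move=> z z1; apply: normed_cvg; apply: (@series_le_cvg _ _ (geometric 1 `|z|)) => /=.
- by move=> n.
- by move=> n; rewrite mul1r exprn_ge0.
- move=> n; rewrite normrM normrX mul1r ler_piMl ?exprn_ge0//.
  by rewrite ger0_norm ?natpmf_ge0 ?natpmf_le1.
- by apply: is_cvg_geometric_series; rewrite normr_id.
Qed.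

Lemma pgf_pseries (z : R) : `|z| < 1 -> pgf P X z = limn (pseries natpmf z).
Proof.
move=> z1; rewrite /pgf (@bounded_expectation_RVnat (fun n => z ^+ n)); last first.
  by move=> n; rewrite normrX exprn_ile1// ltW.
have -> : (\sum_(0 <= n <oo) (z ^+ n * natpmf n)%:E)%E =
    limn (EFin \o pseries natpmf z).
  apply: congr_lim; apply/funext => n /=; rewrite sumEFin /pseries /series/=.
  by under eq_bigr do rewrite mulrC.
by rewrite EFin_lim//; exact: is_cvg_pseries_natpmf.
Qed.

Lemma factorial_moment_tail_sum k :
  ('E_P[fun w => ((X w) ^_ k.+1)%:R] =
   k.+1%:R%:E * \sum_(0 <= n <oo) ((n + k) ^_ k)%:R%:E *
                  P [set w | (n + k < X w)%N])%E.
Proof.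
pose A n := [set w | (n + k < X w)%N].
have mA n : measurable (A n) by exact: (measurable_RVnat [set m | (n + k < m)%N]).
pose g n w : \bar R := ((k.+1 * (n + k) ^_ k)%:R * \1_(A n) w)%:E.
(* Nonnegativity of [g] licenses the exchange of sum and integral; the factor [k.+1] sits inside [g]
   so that the pointwise sum is exactly the hockey-stick sum. *)
have g0 n w : (0 <= g n w)%E by rewrite lee_fin mulr_ge0.
have tailE n : (k.+1%:R%:E * (((n + k) ^_ k)%:R%:E * P (A n)) =
    \int[P]_w g n w)%E.
  rewrite /g; under eq_integral do rewrite EFinM.
  rewrite ge0_integralZl_EFin//; last exact/measurable_EFinP.
  by rewrite integral_indic// setIT muleA -EFinM -natrM.
rewrite -nneseriesZl; last by move=> n _; rewrite mule_ge0// lee_fin.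
rewrite (eq_eseriesr (fun n _ => tailE n)) -integral_nneseries//; last first.
  by move=> n; apply/measurable_EFinP; exact: measurable_funM.
rewrite unlock; apply: eq_integral => w _.
(* The indicator of [A n] at [w] is 1 exactly when [n < X w - k], so the series stops there. *)
rewrite (nneseries_split 0 (X w - k))// add0n.
rewrite [X in (_ + X)%E]eseries0 ?adde0; last first.
  move=> n; rewrite leq_subLR => kn _; rewrite /g indicE memNset ?mulr0//.
  by rewrite /A/= ltnNge addnC kn.
rewrite (eq_big_nat _ _ (F2 := fun n => ((k.+1 * (n + k) ^_ k)%:R : R)%:E)).
  rewrite sumEFin -natr_sum -big_distrr/= sum_ffact_hockey_stick.
  have [kX|Xk] := leqP k (X w); first by rewrite subnK.
  (* If [X w < k], the truncated difference is 0 and both falling factorials vanish. *)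
  by rewrite (eqP (ltnW Xk : X w - k == 0)%N) !ffact_small// ltnW.
move=> n /andP[_ nk]; rewrite /g indicE mem_set ?mulr1//.
by rewrite /A/= addnC -ltn_subRL.
Qed.

End nat_random_variable.

Lemma factorial_moment_pseries d (T : measurableType d) (R : realType)
    (P : probability T R) (X : {RV P >-> nat}) k :
  ('E_P[fun w => ((X w) ^_ k)%:R] =
   \sum_(0 <= n <oo) (iter k (@pseries_diffs R) (natpmf X) n)%:E)%E.
Proof.
rewrite (@ge0_expectation_RVnat _ _ _ _ _ (fun m => (m ^_ k)%:R))//.
have term0 m : (0 <= ((m ^_ k)%:R * natpmf X m)%:E)%E.
  by rewrite lee_fin mulr_ge0 ?natpmf_ge0.
rewrite [LHS](nneseries_split 0 k) ?add0n//.
(* The first [k] terms vanish because [m ^_ k = 0] for [m < k]; shifting the index by [k] leaves the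
   derived coefficients. *)
rewrite big_nat big1 ?add0e; last first.
  by move=> m /andP[_ mk] /=; rewrite ffact_small// mul0r.
rewrite -nneseries_addn; last exact: term0.
by apply: eq_eseriesr => n _; rewrite iter_pseries_diffs.
Qed.

(** * The two identities for the factorial moment *)

(** Derivatives and limits are total operators with default values. The first two clauses certify
    that the iterated derivatives on the disc and the limit, possibly infinite, are genuine. *)
Theorem theorem1p2 (R : realType) (d : measure_display) (T : measurableType d)
    (P : probability T R) (X : {RV P >-> nat}) (N : nat) (hN : (0 < N)%N) :
  [/\ forall (k : nat) (z : R), (k < N)%N -> `|z| < 1 ->
        derivable ((pgf P X)^`(k))%classic z 1,
      cvg (((pgf P X)^`(N)%classic z)%:E @[z --> (1 : R)^'-]),
      ((N%:R^-1)%:E * lim (((pgf P X)^`(N)%classic z)%:E @[z --> (1 : R)^'-])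
       = \sum_(0 <= n <oo) (\prod_(1 <= j < N) (n + j)%:R)%R%:E
                           * P [set w | (n + N - 1 < X w)%N])%E
    & (\sum_(0 <= n <oo) (\prod_(1 <= j < N) (n + j)%:R)%R%:E
                         * P [set w | (n + N - 1 < X w)%N]
       = (N%:R^-1)%:E
         * 'E_P[fun w => (\prod_(0 <= i < N) ((X w)%:R - i%:R))%R])%E ].
Proof.
have pgf_derive1n := derive1n_pseries_disc (@is_cvg_pseries_natpmf _ _ _ _ X)
  (@pgf_pseries _ _ _ _ X).
have cvg_coef k := @is_cvg_iter_pseries_diffs_disc _ k _
  (@is_cvg_pseries_natpmf _ _ _ _ X).
have derivative_cvg : ((pgf P X)^`(N)%classic z)%:E @[z --> (1 : R)^'-] -->
    ('E_P[fun w => ((X w) ^_ N)%:R])%E.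
  rewrite factorial_moment_pseries.
  have coef_ge0 n : 0 <= iter N (@pseries_diffs R) (natpmf X) n.
    by rewrite iter_pseries_diffs mulr_ge0// natpmf_ge0.
  apply: cvg_trans (cvg_pseries_at_left1 coef_ge0 (cvg_coef N)).
  apply: near_eq_cvg; near=> z; rewrite pgf_derive1n// ger0_norm.
    by near: z; exact: nbhs_left_lt.
  by near: z; apply: nbhs_left_ge; exact: ltr01.
have tail_sum : (\sum_(0 <= n <oo) (\prod_(1 <= j < N) (n + j)%:R)%R%:E
      * P [set w | (n + N - 1 < X w)%N]
    = (N%:R^-1)%:E * 'E_P[fun w => ((X w) ^_ N)%:R])%E.
  (* With [N = k.+1], the threshold [n + N - 1] is [n + k] and no subtraction truncates. *)
  case: N hN {derivative_cvg} => // k _.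
  rewrite factorial_moment_tail_sum muleA -EFinM mulVf ?pnatr_eq0// mul1e.
  apply: eq_eseriesr => n _.
  by rewrite -natr_prod prod_ffact addnS subn1.
split.
- move=> k z kN z1.
  by have [] := is_derive_pseries_disc (cvg_coef k) (pgf_derive1n k) z1.
- by apply/cvg_ex; eexists; exact: derivative_cvg.
- by rewrite tail_sum (cvg_lim _ derivative_cvg).
- by rewrite tail_sum; under [in RHS]eq_fun do rewrite prodB_ffact.
Unshelve. all: by end_near. Qed.
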